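(* For every positive integer $\ell$ there is a constant $C_\ell>0$ depending only on $\ell$ such that the following holds for every positive integer $n$ and every Sidon set $S=\{a_1<a_2<\cdots<a_t\}\subset\{1,2,\ldots,n\}$ (with $t=|S|$): if $t\geqslant n^{1/2}-n^{1/4}$, then $$\left|\sum_{i=1}^t i\,a_i^\ell-\frac{1}{\ell+2}t^2n^{\ell}\right|\leqslant C_\ell\, n^{\ell+3/8}\,t,$$ and if $t<n^{1/2}-n^{1/4}$, then $$\left|\sum_{i=1}^t i\,a_i^\ell-\frac{1}{\ell+2}t^2n^{\ell}\right|\leqslant C_\ell\, n^{\ell+1/4}\,t\sqrt{n^{1/2}-t}.$$
   Context: A set $S\subset\{1,2,\ldots,n\}$ is called a Sidon set if all the sums $a+b$ with $a,b\in S$ are different (up to the order of the summands, i.e. the sums $a+b$ with $a\leqslant b$, $a,b\in S$, are pairwise distinct). *)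

(* Defs.v *)
From mathcomp Require Import all_boot all_order all_algebra.
From mathcomp Require Import finmap.
From mathcomp Require Import reals exp.

Set Implicit Arguments.
Unset Strict Implicit.
Unset Printing Implicit Defensive.

Local Open Scope nat_scope.

Definition sidon (S : {fset nat}) : Prop :=
  forall a b c d : nat, a \in S -> b \in S -> c \in S -> d \in S ->
    a <= b -> c <= d -> a + b = c + d -> a = c /\ b = d.

(* The i-th smallest element of S, counted from 1, so that
   S = {elt S 1 < ... < elt S t} with t = #|` S|; only meant for
   1 <= i <= t. *)
Definition elt (S : {fset nat}) (i : nat) : nat :=
  nth 0 (sort leq S) i.-1.

(* Main.v *)
Require Import Defs.
From mathcomp Require Import all_boot all_order all_algebra.
From mathcomp Require Import finmap.
From mathcomp Require Import reals exp.
From mathcomp Require Import zify ring lra.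
Import Order.TTheory GRing.Theory Num.Theory.
Local Open Scope ring_scope.

(** Write [t = #|S|], [q = n^(1/4)], and let [s >= 0] satisfy [s^2 >= q] and
    [s^2 >= q^2 - t].  Both claims say that the error is
    [O(n^l * t * (q * s))]: take [s^2 = q] for large [t], and
    [s^2 = q^2 - t] for small [t].

    The heart of the matter is that a Sidon set is equidistributed: its
    [i]-th element satisfies [a_i * t = i * n + O(n * (q * s))]
    ([elt_equidistribution]).  To see this, slide a window of length [u],
    with [u] about [n^(3/4)], over [n + u] positions, and let [W_k] be the
    number of elements of [S] in the [k]-th window.  Every element lies in
    [u] windows, so [\sum_k W_k = u * t].  A Sidon set meets a translate of
    [{-i, -j}] in both points for at most one translation when [i <> j], so
    [\sum_k W_k^2 <= u * t + u^2] ([sum_window_sq]).  This is so close to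
    the minimum [(u * t)^2 / (n + u)] allowed by Cauchy-Schwarz that the
    [W_k] have a small variance, and hence their partial sums are close to
    linear ([sidon_window_deviation]).  The sum of the first [y] windows is
    at most [u] times the number of elements of [S] below [y], while that
    of the first [y + u] windows is at least this product; so the counting
    function of [S] is also close to linear ([discrepancy_arith]).

    It remains to replace [a_i] by [i * n / t] in [\sum_i i * a_i^l], which
    costs [O(n^l * t * (q * s))] since [x^l] is Lipschitz on [[0, n]], and to
    compare [\sum_(i <= t) i^(l+1)] with [t^(l+2) / (l+2)], which costs
    [O(n^l * t)] ([weighted_power_sum_bound]). *)

(** * Counting functions and sliding windows *)

Definition below (S : {fset nat}) (y : nat) : nat :=
  (\sum_(k < y) ((k : nat) \in S : nat))%N.

(** Written as a count over the offset [i] of the elements of [S] in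
    [(k - u, k]]: the shape in which squares expand into pairs of offsets.
    When [0 \notin S] the truncation of [k - i] at [0] adds nothing. *)
Definition window (S : {fset nat}) (u k : nat) : nat :=
  (\sum_(i < u) ((k - i)%N \in S : nat))%N.

Lemma below_le (S : {fset nat}) (x y : nat) :
  (x <= y)%N -> (below S x <= below S y)%N.
Proof.
move=> /subnKC <-; elim: (y - x)%N => [|d IH]; first by rewrite addn0.
by rewrite addnS /below big_ord_recr /=; apply: leq_trans IH (leq_addr _ _).
Qed.

Lemma below_count (S : {fset nat}) (y : nat) :
  below S y = count (fun a => (a < y)%N) S.
Proof.
have -> : below S y = count [in S] (iota 0 y).
  rewrite /below -(big_mkord xpredT (fun k => (k \in S : nat))) -sum1_count.
  rewrite [RHS]big_mkcond /index_iota subn0 /=.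
  by apply: eq_bigr => k _; case: (k \in S).
rewrite -!size_filter; apply/perm_size/uniq_perm.
- exact: filter_uniq (iota_uniq _ _).
- exact: filter_uniq (fset_uniq _).
by move=> a; rewrite !mem_filter mem_iota /= add0n andbC.
Qed.

Lemma below_le_card (S : {fset nat}) (y : nat) : (below S y <= #|` S|)%N.
Proof. by rewrite below_count count_size. Qed.

Lemma below_all (S : {fset nat}) (y : nat) :
  (forall a, a \in S -> (a < y)%N) -> below S y = #|` S|.
Proof.
move=> ltSy; rewrite below_count; apply/eqP; rewrite -all_count.
exact/allP.
Qed.

Lemma below_elt (S : {fset nat}) (i : nat) :
  (0 < i <= #|` S|)%N -> (below S (elt S i)).+1 = i.
Proof.
case: i => // i /= ltiS; rewrite below_count /elt /=; congr _.+1.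
rewrite -(permP (permEl (perm_sort leq S))).
apply: (@count_lt_nth _ nat); last by rewrite size_sort.
rewrite lt_sorted_uniq_le sort_uniq fset_uniq /=.
exact: (sort_sorted leq_total).
Qed.

Lemma elt_in (S : {fset nat}) (i : nat) :
  (0 < i <= #|` S|)%N -> elt S i \in S.
Proof.
case: i => // i /= ltiS; rewrite /elt -(mem_sort leq).
by apply: mem_nth; rewrite size_sort.
Qed.

Lemma sum_shift (S : {fset nat}) (i y : nat) : 0%N \notin S ->
  (\sum_(k < y) ((k - i)%N \in S : nat) = below S (y - i))%N.
Proof.
move=> /negbTE S0; elim: y => [|y IH].
  by rewrite sub0n /below !big_ord0.
rewrite big_ord_recr /= IH; case: (leqP i y) => [leiy|ltyi].
  by rewrite subSn // /below big_ord_recr.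
have [yi0 Syi0] : (y - i = 0 /\ y.+1 - i = 0)%N by lia.
by rewrite yi0 Syi0 S0 addn0.
Qed.

Lemma sum_window (S : {fset nat}) (u y : nat) : 0%N \notin S ->
  (\sum_(k < y) window S u k = \sum_(i < u) below S (y - i))%N.
Proof.
move=> S0; rewrite exchange_big /=; apply: eq_bigr => i _.
exact: sum_shift.
Qed.

Lemma sum_window_le (S : {fset nat}) (u y : nat) : 0%N \notin S ->
  (\sum_(k < y) window S u k <= u * below S y)%N.
Proof.
move=> S0; rewrite sum_window // -[u in (u * _)%N]card_ord -sum_nat_const.
by apply: leq_sum => i _; apply/below_le/leq_subr.
Qed.

(** The window at [k] only looks backwards, so the elements below [y] have
    been covered by all their [u] windows after [y + u] positions. *)
Lemma sum_window_ge (S : {fset nat}) (u y : nat) : 0%N \notin S ->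
  (u * below S y <= \sum_(k < y + u) window S u k)%N.
Proof.
move=> S0; rewrite sum_window // -[u in (u * _)%N]card_ord -sum_nat_const.
by apply: leq_sum => i _; apply/below_le; have := ltn_ord i; lia.
Qed.

(** * Variance of the window counts of a Sidon set *)

Lemma sum_subsingleton_le1 (m : nat) (P : pred nat) :
  (forall k k', P k -> P k' -> k = k') -> (\sum_(k < m) (P k : nat) <= 1)%N.
Proof.
move=> Puniq.
have -> : (\sum_(k < m) (P k : nat) = #|[pred k : 'I_m | P k]|)%N.
  rewrite -sum1_card [RHS]big_mkcond /=.
  by apply: eq_bigr => k _; rewrite inE; case: (P k).
by apply/card_le1_eqP => k k' Pk Pk'; apply/val_inj/Puniq.
Qed.

(** The difference [(k - i) - (k - j)] of two elements of [S] does not depend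
    on [k], and a nonzero difference has a single representation in a Sidon
    set. *)
Lemma sidon_translate_uniq (S : {fset nat}) (i j k k' : nat) :
  sidon S -> 0%N \notin S -> i <> j ->
  (k - i)%N \in S -> (k - j)%N \in S ->
  (k' - i)%N \in S -> (k' - j)%N \in S -> k = k'.
Proof.
move=> sidS S0 neij ki kj k'i k'j.
have pos a : a \in S -> (0 < a)%N.
  by case: a => // a0; rewrite a0 in S0.
have := (pos _ ki, pos _ kj, pos _ k'i, pos _ k'j) => -[[[p1 p2] p3] p4].
(* Sorting the summands on each side, the Sidon property gives either
   k - i = k' - i, as wanted, or k - i = k - j, which i <> j forbids. *)
have e : ((k - i) + (k' - j) = (k' - i) + (k - j))%N by lia.
case: (leqP (k - i) (k' - j)) => h1; case: (leqP (k' - i) (k - j)) => h2.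
- by have [] := sidS _ _ _ _ ki k'j k'i kj h1 h2 e; lia.
- by have [] := sidS _ _ _ _ ki k'j kj k'i h1 (ltnW h2); lia.
- by have [] := sidS _ _ _ _ k'j ki k'i kj (ltnW h1) h2; lia.
- by have [] := sidS _ _ _ _ k'j ki kj k'i (ltnW h1) (ltnW h2); lia.
Qed.

(** Expand the square over pairs of offsets [(i, j)] and sum over [k] first:
    a diagonal pair contributes at most [#|S|], and an off-diagonal pair at
    most [1]. *)
Lemma sum_window_sq (S : {fset nat}) (u m : nat) :
  sidon S -> 0%N \notin S ->
  (\sum_(k < m) window S u k ^ 2 <= u * (u + #|` S|))%N.
Proof.
move=> sidS S0.
under eq_bigr => k _.
  rewrite -mulnn /window big_distrl /=.
  under eq_bigr => i _ do rewrite big_distrr /=.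
  over.
rewrite exchange_big /= -[u in (u * _)%N]card_ord -sum_nat_const.
apply: leq_sum => i _; rewrite exchange_big /=.
rewrite (bigD1 i) //= addnC leq_add //.
  rewrite -[leqRHS]card_ord -sum1_card big_mkcond [leqRHS]big_mkcond /=.
  apply: leq_sum => j _; case: ifP => // /eqP neji.
  under eq_bigr do rewrite mulnb.
  apply: (@sum_subsingleton_le1 m
    (fun k => ((k - i)%N \in S) && ((k - j)%N \in S))).
  move=> k k' /andP[? ?] /andP[? ?].
  by apply: (@sidon_translate_uniq S i j) => // /val_inj/esym.
under eq_bigr do rewrite mulnb andbb.
by rewrite sum_shift // below_le_card.
Qed.

Lemma sum_deviation_sq (R : comRingType) (m : nat) (w : nat -> R) :
  \sum_(k < m) (m%:R * w k - \sum_(j < m) w j) ^+ 2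
  = m%:R * (m%:R * \sum_(k < m) w k ^+ 2 - (\sum_(k < m) w k) ^+ 2).
Proof.
set T := \sum_(j < m) w j.
under eq_bigr => k _.
  have -> : (m%:R * w k - T) ^+ 2
      = m%:R ^+ 2 * w k ^+ 2 - (2 * m%:R * T) * w k + T ^+ 2 by ring.
  over.
rewrite big_split sumrB -!mulr_sumr sumr_const card_ord -/T /=.
by ring.
Qed.

(** Cauchy-Schwarz against the constant sequence, read off the nonnegativity
    of the variance. *)
Lemma sum_sq_le (R : realFieldType) (m : nat) (w : nat -> R) :
  (\sum_(k < m) w k) ^+ 2 <= m%:R * \sum_(k < m) w k ^+ 2.
Proof.
case: m => [|m]; first by rewrite !big_ord0 mul0r expr0n.
rewrite -subr_ge0 -(pmulr_rge0 _ (ltr0Sn R m)) -sum_deviation_sq.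
by apply: sumr_ge0 => k _; apply: sqr_ge0.
Qed.

(** A sequence of small variance has nearly linear partial sums: apply
    Cauchy-Schwarz to the first [y] centred terms, and bound their squares by
    the squares of all the terms.  Everything is multiplied by [m] so that the
    mean needs no division. *)
Lemma partial_sum_deviation (R : realFieldType) (m y : nat) (w : nat -> R) :
  (y <= m)%N ->
  (m%:R * \sum_(k < y) w k - y%:R * \sum_(k < m) w k) ^+ 2
  <= m%:R ^+ 2 * (m%:R * \sum_(k < m) w k ^+ 2 - (\sum_(k < m) w k) ^+ 2).
Proof.
move=> leym; set T := \sum_(k < m) w k.
pose g k := m%:R * w k - T.
have -> : m%:R * \sum_(k < y) w k - y%:R * T = \sum_(k < y) g k.
  by rewrite sumrB -mulr_sumr sumr_const card_ord -[T *+ y]mulr_natl.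
apply: le_trans (sum_sq_le _ _ _) _.
rewrite expr2 -mulrA -sum_deviation_sq -/T.
apply: ler_pM; rewrite ?ler_nat //.
  by apply: sumr_ge0 => k _; apply: sqr_ge0.
rewrite (big_ord_widen _ (fun k => g k ^+ 2) leym) [leLHS]big_mkcond.
by apply: ler_sum => k _; case: ifP => // _; apply: sqr_ge0.
Qed.

(** The [n + u] positions contain all [u] windows through each element of
    [S], so the total count is exactly [u * #|S|]. *)
Lemma sidon_window_deviation (R : realFieldType) (S : {fset nat})
    (n u y : nat) :
  sidon S -> (forall a, a \in S -> (1 <= a <= n)%N) -> (y <= n + u)%N ->
  ((n + u)%:R * (\sum_(k < y) window S u k)%N%:R
     - y%:R * (u%:R * #|` S|%:R)) ^+ 2
  <= (n + u)%:R ^+ 2 * ((n + u)%:R * (u%:R * (u%:R + #|` S|%:R))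
     - (u%:R * #|` S|%:R) ^+ 2) :> R.
Proof.
move=> sidS Sn leym.
have S0 : 0%N \notin S by apply/negP => /Sn.
have total : (\sum_(k < n + u) window S u k = u * #|` S|)%N.
  apply/eqP; rewrite eqn_leq; apply/andP; split.
    apply: leq_trans (sum_window_le _ _ _ S0) _.
    by rewrite leq_mul2l below_le_card orbT.
  have -> : #|` S| = below S n.+1.
    by rewrite below_all // => a /Sn; lia.
  rewrite sum_window // -[u in (u * _)%N]card_ord -sum_nat_const.
  apply: leq_sum => i _; rewrite below_all; last by move=> a /Sn; lia.
  rewrite below_all // => a /Sn; have := ltn_ord i; lia.
have totalR : \sum_(k < n + u) (window S u k)%:R = u%:R * #|` S|%:R :> R.
  by rewrite -natr_sum total natrM.
have := @partial_sum_deviation R (n + u) y (fun k => (window S u k)%:R) leym.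
rewrite totalR -natr_sum => /le_trans; apply.
rewrite ler_wpM2l ?sqr_ge0 // lerD2r ler_wpM2l //.
under eq_bigr do rewrite -natrX.
by rewrite -natr_sum -natrD -natrM ler_nat sum_window_sq.
Qed.

(** * Equidistribution of Sidon sets *)

Lemma normr_le_of_sqr (R : realDomainType) (x d : R) :
  0 <= d -> x ^+ 2 <= d ^+ 2 -> `|x| <= d.
Proof.
move=> d0; rewrite -(real_normK (num_real x)) ler_pXn2r ?nnegrE //.
Qed.

(** From window sums to the counting function, by real arithmetic only: [B]
    stands for the number of elements of a set of size [t] below [y], and
    [w1], [w2] for the sums of its first [y] and [y + u] window counts.
    As [m - t^2] is at most [4 * q^2 * s^2], the variance [V] is at
    most [(7 * q^4 * s)^2], and dividing by [u >= q^3] leaves a discrepancy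
    [7 * (q * s)].  The shift from [y] to [y + u] costs
    [u * t / q^4 <= 8 * (q * s)] more, and so does the replacement of [m] by
    [q^4]; these two errors occur on opposite sides, whence [15]. *)
Lemma discrepancy_arith (R : realFieldType) (q s u t B y w1 w2 : R) :
  1 <= q -> 0 <= s -> q <= s ^+ 2 -> q ^+ 2 - t <= s ^+ 2 ->
  q ^+ 3 <= u -> u <= 2 * q ^+ 3 -> 0 <= t -> 0 <= y -> y <= q ^+ 4 ->
  let m := q ^+ 4 + u in
  let V := m * (u * (u + t)) - (u * t) ^+ 2 in
  w1 <= u * B -> u * B <= w2 ->
  (m * w1 - y * (u * t)) ^+ 2 <= m ^+ 2 * V ->
  (m * w2 - (y + u) * (u * t)) ^+ 2 <= m ^+ 2 * V ->
  `|B * q ^+ 4 - y * t| <= 15 * q ^+ 4 * (q * s).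
Proof.
move=> q1 s0 qM tM qu uq t0 y0 yn m V w1B w2B dev1 dev2.
have s1 : 1 <= s by rewrite -(ler_pXn2r (ltn0Sn 1)) ?nnegrE // expr1n; lra.
set M := s ^+ 2 in qM tM; have M0 : 0 <= M by apply: sqr_ge0.
have q2 : q <= q ^+ 2 by nra.
have q3 : q ^+ 2 <= q ^+ 3 by rewrite (exprS q 2); nra.
have q4 : q ^+ 3 <= q ^+ 4 by rewrite (exprS q 3); nra.
have u0 : 0 < u by lra.
have m0 : 0 < m by rewrite /m; lra.
have mn : q ^+ 4 <= m by rewrite /m; lra.
have m3 : m <= 3 * q ^+ 4 by rewrite /m; lra.
have V0 : 0 <= V.
  rewrite -(pmulr_rge0 _ (exprn_gt0 2 m0)).
  by apply: le_trans dev1; apply: sqr_ge0.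
have q0 : 0 < q by lra.
have qn0 k : 0 <= q ^+ k by rewrite exprn_ge0 // ltW.
have q4u : q ^+ 4 <= q * u by rewrite (exprS q 3) ler_pM2l.
have uqu : u <= q * u by rewrite ler_peMl // ltW.
(* The nonnegativity of the variance already bounds the size of S. *)
have t4 : t <= 4 * q ^+ 2.
  have ut2 : t ^+ 2 <= m + 2 * q * t.
    have ut : u * t ^+ 2 <= m * (u + t).
      by rewrite -(ler_pM2l u0); move: V0; rewrite /V; lra.
    have mt : m * t <= 2 * (q * u) * t by rewrite ler_wpM2r // /m; lra.
    by rewrite -(ler_pM2l u0); lra.
  rewrite leNgt; apply/negP => lt_t.
  have qt : 2 * q * t <= 2 * q ^+ 2 * t by rewrite ler_wpM2r //; lra.
  have q2_0 : 0 <= 4 * q ^+ 2 by lra.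
  have := ler_pM q2_0 q2_0 (ltW lt_t) (ltW lt_t).
  have := ler_wpM2r t0 (ltW lt_t).
  have : q ^+ 4 = q ^+ 2 * q ^+ 2 by rewrite -exprD.
  lra.
have mt : m - t ^+ 2 <= 4 * q ^+ 2 * M.
  have q4E : q ^+ 4 = q ^+ 2 * q ^+ 2 by rewrite -exprD.
  have q3M : q ^+ 3 <= q ^+ 2 * M by rewrite exprSr ler_wpM2l.
  suff : q ^+ 4 - t ^+ 2 <= 2 * q ^+ 2 * M by rewrite /m; lra.
  have [le_qt|lt_tq] := lerP (q ^+ 2) t.
    have := ler_pM (qn0 2) (qn0 2) le_qt le_qt.
    have := mulr_ge0 (qn0 2) M0; lra.
  have h1 : 0 <= q ^+ 2 - t by lra.
  have h2 : 0 <= q ^+ 2 + t by have := qn0 2; lra.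
  have h3 : q ^+ 2 + t <= 2 * q ^+ 2 by lra.
  have := ler_pM h1 h2 tM h3; lra.
have VD : V <= (7 * q ^+ 4 * s) ^+ 2.
  have mu : m * u <= (3 * q ^+ 4) * (2 * q ^+ 3).
    by apply: ler_pM => //; apply: ltW.
  have mut : m * u * t <= (3 * q ^+ 4) * (2 * q ^+ 3) * (4 * q ^+ 2).
    by apply: ler_pM => //; rewrite mulr_ge0 // ltW.
  have uu : u * u <= (2 * q ^+ 3) * (2 * q ^+ 3).
    by apply: ler_pM => //; apply: ltW.
  have uumt : u * u * (m - t ^+ 2)
      <= (2 * q ^+ 3) * (2 * q ^+ 3) * (4 * q ^+ 2 * M).
    have uu0 : 0 <= u * u by rewrite mulr_ge0 // ltW.
    have q2M0 : 0 <= 4 * q ^+ 2 * M by rewrite mulr_ge0 //; have := qn0 2; lra.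
    exact: le_trans (ler_wpM2l uu0 mt) (ler_wpM2r q2M0 uu).
  have q9 : q ^+ 9 <= q ^+ 8 * M by rewrite exprSr ler_wpM2l.
  have -> : (7 * q ^+ 4 * s) ^+ 2 = 49 * (q ^+ 8 * M) by rewrite /M; ring.
  have := mulr_ge0 (qn0 8) M0.
  by rewrite /V; lra.
have D0 : 0 <= m * (7 * q ^+ 4 * s).
  by rewrite !mulr_ge0 ?(ltW m0) ?exprn_ge0 //; lra.
have dev w z : (m * w - z) ^+ 2 <= m ^+ 2 * V ->
    `|m * w - z| <= m * (7 * q ^+ 4 * s).
  move=> h; apply: normr_le_of_sqr => //; apply: le_trans h _.
  by rewrite [leRHS]exprMn ler_wpM2l ?sqr_ge0.
have := dev _ _ dev1; have := dev _ _ dev2.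
rewrite !ler_norml => /andP[_ up] /andP[lo _].
have ms0 : 0 <= m * s by rewrite mulr_ge0 ?(ltW m0) //; lra.
have Dle : m * (7 * q ^+ 4 * s) <= u * (7 * m * (q * s)).
  by have := ler_wpM2l ms0 q4u; lra.
have up' : m * B <= (y + u) * t + 7 * m * (q * s).
  by rewrite -(ler_pM2l u0); have := ler_wpM2l (ltW m0) w2B; lra.
have lo' : y * t - 7 * m * (q * s) <= m * B.
  by rewrite -(ler_pM2l u0); have := ler_wpM2l (ltW m0) w1B; lra.
have qs0 : 0 <= q * s by rewrite mulr_ge0; lra.
have utle : u * t <= 8 * (q ^+ 4 * (q * s)).
  have ut : u * t <= (2 * q ^+ 3) * (4 * q ^+ 2).
    by apply: ler_pM => //; apply: ltW.
  by have := ler_peMr (qn0 5) s1; lra.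
have mqs : q ^+ 4 * (q * s) <= m * (q * s) by rewrite ler_wpM2r.
have yt0 := mulr_ge0 y0 t0.
rewrite -(ler_pM2l m0) -[_ - _ <= _](ler_pM2l m0); apply/andP; split.
  have := ler_wpM2l (qn0 4) lo'.
  have := ler_wpM2r y0 utle.
  have := ler_pM y0 (mulr_ge0 (qn0 4) qs0) yn mqs.
  rewrite /m; lra.
have := ler_wpM2l (qn0 4) up'.
have := ler_wpM2l (qn0 4) utle.
have := ler_wpM2l (qn0 4) mqs.
have := ler_wpM2r yt0 mn.
lra.
Qed.

(** The counting function of [S] at [a_i] is [i - 1], so its discrepancy there
    is the deviation of [a_i] from [i * n / #|S|]. *)
Lemma elt_equidistribution (R : archiRealFieldType) (S : {fset nat}) (n : nat)
    (q s : R) (i : nat) :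
  sidon S -> (forall a, a \in S -> (1 <= a <= n)%N) ->
  1 <= q -> q ^+ 4 = n%:R -> 0 <= s -> q <= s ^+ 2 ->
  q ^+ 2 - #|` S|%:R <= s ^+ 2 -> (0 < i <= #|` S|)%N ->
  `|(elt S i)%:R * #|` S|%:R - i%:R * n%:R| <= 16 * n%:R * (q * s) :> R.
Proof.
move=> sidS Sn q1 qn s0 qs ts iS.
have S0 : 0%N \notin S by apply/negP => /Sn.
have /andP[y1 yn] := Sn _ (elt_in _ _ iS).
set y := elt S i in y1 yn *; set B := below S y.
have iB : i = B.+1 by rewrite /B below_elt.
have q30 : 0 <= q ^+ 3 by rewrite exprn_ge0 //; lra.
have q31 : 1 <= q ^+ 3 by rewrite exprn_ege1.
(* A length of order n^(3/4) balances the terms m * u * t and u^3 of the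
   variance bound. *)
pose u := (Num.truncn (q ^+ 3)).+1.
have /andP[ul uu] := truncn_itv q30.
have qu : q ^+ 3 <= u%:R by exact: ltW.
have uq : u%:R <= 2 * q ^+ 3 by rewrite /u -natr1; lra.
have ley : (y <= n + u)%N by lia.
have leyu : (y + u <= n + u)%N by lia.
have dev1 := @sidon_window_deviation R S n u y sidS Sn ley.
have dev2 := @sidon_window_deviation R S n u (y + u) sidS Sn leyu.
have w1 : (\sum_(k < y) window S u k)%N%:R <= u%:R * B%:R :> R.
  by rewrite -natrM ler_nat sum_window_le.
have w2 : u%:R * B%:R <= (\sum_(k < y + u) window S u k)%N%:R :> R.
  by rewrite -natrM ler_nat sum_window_ge.
rewrite !(natrD _ n u) -qn in dev1 dev2; rewrite (natrD _ y u) in dev2.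
have ynR : y%:R <= q ^+ 4 by rewrite qn ler_nat.
have := @discrepancy_arith R q s u%:R #|` S|%:R B%:R y%:R _ _
  q1 s0 qs ts qu uq (ler0n _ _) (ler0n _ _) ynR w1 w2 dev1 dev2.
have s1 : 1 <= s by rewrite -(ler_pXn2r (ltn0Sn 1)) ?nnegrE // expr1n; lra.
have qs1 : 1 <= q * s by rewrite mulr_ege1.
have n0 := ler0n R n; have := ler_wpM2l n0 qs1.
(* Passing from B = i - 1 to i turns 15 into 16. *)
rewrite iB -[B.+1%:R]natr1 qn !ler_norml => h /andP[h1 h2].
apply/andP; split; lra.
Qed.

(** * Comparison with power sums *)

Lemma normrXB_le (R : realDomainType) (l : nat) (x y K : R) :
  0 <= x <= K -> 0 <= y <= K ->
  `|x ^+ l.+1 - y ^+ l.+1| <= l.+1%:R * K ^+ l * `|x - y|.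
Proof.
move=> /andP[x0 xK] /andP[y0 yK]; have K0 := le_trans x0 xK.
elim: l => [|l IH]; first by rewrite !expr1 expr0 !mul1r.
have -> : x ^+ l.+2 - y ^+ l.+2
    = x * (x ^+ l.+1 - y ^+ l.+1) + (x - y) * y ^+ l.+1.
  by rewrite !(exprS _ l.+1); ring.
apply: le_trans (ler_normD _ _) _; rewrite !normrM.
rewrite (ger0_norm x0) (ger0_norm (exprn_ge0 _ y0)).
have -> : l.+2%:R * K ^+ l.+1 * `|x - y| =
    K * (l.+1%:R * K ^+ l * `|x - y|) + `|x - y| * K ^+ l.+1.
  by rewrite -natr1 exprS; ring.
apply: lerD; first exact: ler_pM.
by rewrite ler_wpM2l // lerXn2r.
Qed.

Lemma exprS_increment_bounds (R : realDomainType) (l : nat) (x : R) :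
  0 <= x ->
  l.+1%:R * x ^+ l <= (x + 1) ^+ l.+1 - x ^+ l.+1 <= l.+1%:R * (x + 1) ^+ l.
Proof.
move=> x0; have x10 : 0 <= x + 1 by lra.
have leX k : x ^+ k <= (x + 1) ^+ k by rewrite lerXn2r ?nnegrE // lerDl.
elim: l => [|l /andP[lo up]]; first by rewrite !expr1 !expr0; lra.
have -> : (x + 1) ^+ l.+2 - x ^+ l.+2
    = (x + 1) * ((x + 1) ^+ l.+1 - x ^+ l.+1) + x ^+ l.+1.
  by rewrite !(exprS _ l.+1); ring.
have step (z : R) : l.+2%:R * z ^+ l.+1 = z * (l.+1%:R * z ^+ l) + z ^+ l.+1.
  by rewrite exprS -[l.+2%:R]natr1; ring.
rewrite !step; apply/andP; split; apply: lerD => //; last exact: ler_wpM2l.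
apply: ler_pM => //; last by lra.
by rewrite mulr_ge0 ?exprn_ge0.
Qed.

(** Telescope [exprS_increment_bounds]; this is the comparison of the sum with
    the integral of [x^l] over [[0, t]]. *)
Lemma power_sum_bounds (R : realDomainType) (l t : nat) :
  (t%:R ^+ l.+1 : R) <= l.+1%:R * \sum_(1 <= i < t.+1) i%:R ^+ l
  <= (t%:R ^+ l.+1 + l.+1%:R * t%:R ^+ l : R).
Proof.
elim: t => [|t /andP[lo up]].
  by rewrite big_geq // mulr0 expr0n add0r lexx /= mulr_ge0 ?exprn_ge0.
have /andP[lo1 up1] := exprS_increment_bounds R l _ (ler0n R t).
rewrite natr1 in lo1 up1.
rewrite big_nat_recr //= mulrDr; apply/andP; split; lra.
Qed.

(** Any set whose elements are within [O(n * P / t)] of the equally spaced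
    points [i * n / t] has almost their weighted power sum.  The proof
    multiplies by [t^l] to clear the denominators of these points. *)
Lemma weighted_power_sum_bound (R : realFieldType) (S : {fset nat})
    (n l : nat) (P : R) :
  (forall a, a \in S -> (1 <= a <= n)%N) -> 1 <= P ->
  (forall i, (0 < i <= #|` S|)%N ->
    `|(elt S i)%:R * #|` S|%:R - i%:R * n%:R| <= 16 * n%:R * P) ->
  `| \sum_(1 <= i < #|` S|.+1) i%:R * (elt S i)%:R ^+ l.+1
     - 1 / (l.+1 + 2)%:R * #|` S|%:R ^+ 2 * n%:R ^+ l.+1 |
  <= (16 * l.+1%:R + 1) * n%:R ^+ l.+1 * #|` S|%:R * P.
Proof.
move=> Sn P1 equi; set t := #|` S| in equi *.
have [t0|t0] := posnP t.
  by rewrite t0 big_geq // expr0n /= !(mulr0, mul0r) subr0 normr0.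
pose T : R := t%:R; pose N : R := n%:R.
have T0 : 0 < T by rewrite ltr0n.
have N0 : 0 <= N by apply: ler0n.
have P0 : 0 <= P by lra.
set L := l.+1.
set A := \sum_(1 <= i < t.+1) i%:R * (elt S i)%:R ^+ L.
pose B : R := \sum_(1 <= i < t.+1) i%:R ^+ L.+1.
have cmp : `|T ^+ L * A - N ^+ L * B| <= T * (16 * L%:R * (T * N) ^+ L * P).
  rewrite !mulr_sumr -sumrB; apply: le_trans (ler_norm_sum _ _ _) _.
  have -> (x : R) : T * x = \sum_(1 <= i < t.+1) x.
    by rewrite sumr_const_nat subn1 mulr_natl.
  rewrite big_nat [leRHS]big_nat.
  apply: ler_sum => i /andP[i1 it].
  have iS : (0 < i <= t)%N by rewrite i1.
  have /andP[a1 an] := Sn _ (elt_in _ _ iS).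
  have iT : i%:R <= T by rewrite ler_nat.
  have -> : T ^+ L * (i%:R * (elt S i)%:R ^+ L) - N ^+ L * i%:R ^+ L.+1
      = i%:R * (((elt S i)%:R * T) ^+ L - (i%:R * N) ^+ L).
    by rewrite !exprMn exprS; ring.
  rewrite normrM ger0_norm ?ler0n //.
  have aK : 0 <= (elt S i)%:R * T <= T * N.
    by rewrite mulr_ge0 ?ler0n //= [leLHS]mulrC ler_pM2l // ler_nat.
  have iK : 0 <= i%:R * N <= T * N.
    by rewrite mulr_ge0 ?ler0n //= ler_wpM2r.
  have K0 : 0 <= T * N by rewrite mulr_ge0 ?ler0n.
  apply: le_trans (ler_wpM2l (ler0n _ _) (normrXB_le R l _ _ _ aK iK)) _.
  have -> : 16 * L%:R * (T * N) ^+ L * P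
      = T * (L%:R * (T * N) ^+ l * (16 * N * P)) by rewrite exprS; ring.
  apply: ler_pM; rewrite ?ler0n ?mulr_ge0 ?exprn_ge0 //.
  by rewrite ler_wpM2l ?equi // mulr_ge0 ?exprn_ge0.
have L2 : (L + 2)%:R = L.+2%:R :> R by rewrite addn2.
have L20 : 0 < L.+2%:R :> R by rewrite ltr0n.
have /andP[lo up] := power_sum_bounds R L.+1 t.
rewrite -/T -/B in lo up.
have powers : `|B - 1 / (L + 2)%:R * T ^+ 2 * T ^+ L| <= T ^+ L.+1.
  rewrite L2 ler_norml -(ler_pM2l L20) -[_ - _ <= _](ler_pM2l L20).
  have -> : L.+2%:R * (B - 1 / L.+2%:R * T ^+ 2 * T ^+ L)
      = L.+2%:R * B - T ^+ L.+2.
    by rewrite mulrBr mul1r -mulrA mulVKf -?exprD // gt_eqF.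
  have := mulr_ge0 (ltW L20) (exprn_ge0 L.+1 (ltW T0)).
  move=> ?; apply/andP; split; lra.
have TL0 : 0 < T ^+ L by rewrite exprn_gt0.
rewrite -(ler_pM2l TL0) -[X in X * `|_|](gtr0_norm TL0) -normrM.
have -> : T ^+ L * (A - 1 / (L + 2)%:R * T ^+ 2 * N ^+ L)
    = (T ^+ L * A - N ^+ L * B)
      + N ^+ L * (B - 1 / (L + 2)%:R * T ^+ 2 * T ^+ L) by ring.
apply: le_trans (ler_normD _ _) _.
have -> : T ^+ L * ((16 * L%:R + 1) * N ^+ L * T * P)
    = T * (16 * L%:R * (T * N) ^+ L * P) + N ^+ L * (T ^+ L.+1 * P).
  by rewrite exprMn exprS; ring.
apply: lerD cmp _.
rewrite normrM ger0_norm ?exprn_ge0 // ler_wpM2l ?exprn_ge0 //.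
by apply: le_trans powers _; rewrite ler_peMr // exprn_ge0 // ltW.
Qed.

(** * The asymptotic formula *)

Theorem theorem6 (R : realType) (l : nat) (hl : (0 < l)%N) :
  exists C : R, 0 < C /\
    forall (n : nat) (S : {fset nat}),
      (0 < n)%N ->
      (forall a : nat, a \in S -> (1 <= a <= n)%N) ->
      sidon S ->
      let t := #|` S|%fset in
      let N : R := n%:R in
      let E : R :=
        `| \sum_(1 <= i < t.+1) i%:R * (elt S i)%:R ^+ l
           - 1 / (l + 2)%:R * t%:R ^+ 2 * N ^+ l | in
      (N `^ (1 / 2) - N `^ (1 / 4) <= t%:R ->
         E <= C * N `^ (l%:R + 3 / 8) * t%:R) /\
      (t%:R < N `^ (1 / 2) - N `^ (1 / 4) ->
         E <= C * N `^ (l%:R + 1 / 4) * t%:R * Num.sqrt (N `^ (1 / 2) - t%:R)).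
Proof.
case: l hl => // l _; exists (16 * l.+1%:R + 1); split.
  by rewrite ltr_wpDl // mulr_ge0.
move=> n S n0 Sn sidS t N E.
have N1 : 1 <= N by rewrite ler1n.
have N0 : 0 <= N by lra.
set q := N `^ (1 / 4).
have powX (r : R) (k : nat) : (N `^ r) ^+ k = N `^ (r * k%:R).
  by rewrite -powR_mulrn ?powR_ge0 // -powRrM.
have q1 : 1 <= q by rewrite -(powRr0 N) ler_powR //; lra.
have q4 : q ^+ 4 = N by rewrite powX -[RHS]powRr1 //; congr (_ `^ _); lra.
have q2 : N `^ (1 / 2) = q ^+ 2 by rewrite powX; congr (_ `^ _); lra.
have powD (r : R) : N `^ (l.+1%:R + r) = N ^+ l.+1 * N `^ r.
  by rewrite powRD ?powR_mulrn //; apply/implyP => _; rewrite gt_eqF //; lra.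
have key (s : R) : 0 <= s -> q <= s ^+ 2 -> q ^+ 2 - t%:R <= s ^+ 2 ->
    E <= (16 * l.+1%:R + 1) * N ^+ l.+1 * t%:R * (q * s).
  move=> s0 qs ts; apply: weighted_power_sum_bound => //.
    have s1 : 1 <= s by rewrite -(ler_pXn2r (ltn0Sn 1)) ?nnegrE // expr1n; lra.
    by rewrite mulr_ege1.
  by move=> i iS; apply: elt_equidistribution.
rewrite !powD q2; split=> ht.
  set s := N `^ (1 / 8).
  have s2 : s ^+ 2 = q by rewrite powX; congr (_ `^ _); lra.
  have -> : N `^ (3 / 8) = q * s.
    by rewrite -s2 -exprSr powX; congr (_ `^ _); lra.
  have -> : (16 * l.+1%:R + 1) * (N ^+ l.+1 * (q * s)) * t%:R =
    (16 * l.+1%:R + 1) * N ^+ l.+1 * t%:R * (q * s) by ring.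
  by apply: key; rewrite ?powR_ge0 // s2; lra.
have s2 : Num.sqrt (q ^+ 2 - t%:R) ^+ 2 = q ^+ 2 - t%:R.
  by rewrite sqr_sqrtr //; lra.
have -> (s : R) : (16 * l.+1%:R + 1) * (N ^+ l.+1 * q) * t%:R * s =
  (16 * l.+1%:R + 1) * N ^+ l.+1 * t%:R * (q * s) by ring.
by apply: key; rewrite ?sqrtr_ge0 // s2; lra.
Qed.
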